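(* Let $(\mathfrak{g},\pi,T)$ be an extended Rota-Baxter Lie algebra of weight $(\mu,\lambda)$. If $H^2_{\mathrm{RBA}_{(\mu,\lambda)}}(\mathfrak{g})=0$, then $(\mathfrak{g},\pi,T)$ is rigid.
   Context: $\mathbf{k}$ is a field of characteristic $0$, $\mu,\lambda\in\mathbf{k}$, and $\mathbf{k}$ contains a square root of $\mu^2-4\lambda$. An extended Rota-Baxter Lie algebra of weight $(\mu,\lambda)$ is a Lie algebra $(\mathfrak{g},\pi=[-,-])$ with a linear map $T:\mathfrak{g}\to\mathfrak{g}$ such that $[Ta,Tb]=T([Ta,b]+[a,Tb]+\mu[a,b])+\lambda[a,b]$. A $1$-parameter formal deformation of $(\mathfrak{g},\pi,T)$ is a pair $\mu_t=\sum_{i\ge0}\mu_it^i$, $T_t=\sum_{i\ge0}T_it^i$ with $\mu_i\in\mathrm{Hom}(\wedge^2\mathfrak{g},\mathfrak{g})$, $T_i\in\mathrm{Hom}(\mathfrak{g},\mathfrak{g})$, $\mu_0=\pi$, $T_0=T$, making $\mathfrak{g}[[t]]$ an extended Rota-Baxter Lie algebra of weight $(\mu,\lambda)$ over $\mathbf{k}[[t]]$. Two deformations $(\mu_t,T_t)$, $(\mu'_t,T'_t)$ are equivalent if there is a power series $\psi_t=\sum_{i\ge0}\psi_it^i$ with $\psi_i:\mathfrak{g}\to\mathfrak{g}$ linear, $\psi_0=\mathrm{Id}_{\mathfrak{g}}$, such that $\psi_t\circ\mu'_t=\mu_t\circ(\psi_t\otimes\psi_t)$ and $\psi_t\circ T'_t=T_t\circ\psi_t$.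 A deformation is trivial if it is equivalent to the one with $\mu_i=0$, $T_i=0$ for all $i\ge1$. $(\mathfrak{g},\pi,T)$ is rigid if every $1$-parameter formal deformation is trivial. Constants: $B_0=0$, $B_1=1$, $B_{n+1}=\mu B_n-\lambda B_{n-1}$; $A_n=\lambda B_n$ for $n\ge0$, $A_{-1}=-1$. The complex $C^*_{\mathrm{RBA}_{(\mu,\lambda)}}(\mathfrak{g})$: $C^n=\mathrm{Hom}(\wedge^n\mathfrak{g},\mathfrak{g})\oplus\mathrm{Hom}(\wedge^{n-1}\mathfrak{g},\mathfrak{g})$, $n\ge0$, with $\partial_{\mathrm{RBA}_{(\mu,\lambda)}}(f,g)=(\partial_{\mathrm{Lie}}f,\,-\partial_{\mathrm{RB}}g-\delta f)$ and cohomology $H^n_{\mathrm{RBA}_{(\mu,\lambda)}}(\mathfrak{g})$, where for $f\in\mathrm{Hom}(\wedge^n\mathfrak{g},\mathfrak{g})$ $$\partial_{\mathrm{Lie}}(f)(x_1,\dots,x_{n+1})=\sum_{i}(-1)^{i+n}[x_i,f(x_1,\dots,\hat x_i,\dots,x_{n+1})]+\sum_{i<j}(-1)^{i+j+n+1}f([x_i,x_j],x_1,\dots,\hat x_i,\dots,\hat x_j,\dots,x_{n+1}),$$ $$\partial_{\mathrm{RB}}(f)(x_1,\dots,x_{n+1})=\sum_{i}(-1)^{i+n}\big([Tx_i,f(\dots\hat x_i\dots)]-T[x_i,f(\dots\hat x_i\dots)]\big)+\sum_{i<j}(-1)^{i+j+n+1}f([Tx_i,x_j]+[x_i,Tx_j]+\mu[x_i,x_j],x_1,\dots,\hat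 x_i,\dots,\hat x_j,\dots,x_{n+1}),$$ $$\delta(f)(x_1,\dots,x_n)=-\sum_{k=0}^n\sum_{\tau\in\mathrm{Sh}(k,n-k)}\mathrm{sgn}(\tau)A_{n-k-1}f(Tx_{\tau(1)},\dots,Tx_{\tau(k)},x_{\tau(k+1)},\dots,x_{\tau(n)})-\sum_{k=1}^n\sum_{\tau\in\mathrm{Sh}(k-1,n-k+1)}\mathrm{sgn}(\tau)B_{n-k+1}Tf(Tx_{\tau(1)},\dots,Tx_{\tau(k-1)},x_{\tau(k)},\dots,x_{\tau(n)}),$$ $\mathrm{Sh}(p,q)$ denoting $(p,q)$-shuffles. *)

(* Defs.v *)
From HB Require Import structures.
From mathcomp Require Import all_boot all_fingroup all_algebra.
From mathcomp Require Import boolp functions.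

Set Implicit Arguments.
Unset Strict Implicit.
Unset Printing Implicit Defensive.

Import GRing.Theory.
Local Open Scope ring_scope.

Section ExtendedRotaBaxterLie.
Variables (R : comNzRingType) (L : lmodType R).

Definition is_lie_bracket (br : L -> L -> L) : Prop :=
  [/\ bilinear_for *:%R *:%R br,
      forall x, br x x = 0
    & forall x y z, br x (br y z) + br y (br z x) + br z (br x y) = 0].

Definition is_erb_lie (mu lambda : R) (br : L -> L -> L) (T : L -> L) : Prop :=
  [/\ is_lie_bracket br,
      GRing.linear_for *:%R T
    & forall a b, br (T a) (T b) =
        T (br (T a) b + br a (T b) + mu *: br a b) + lambda *: br a b].

End ExtendedRotaBaxterLie.

Section Cohomology.
Variables (k : fieldType) (g : lmodType k).

(* An n-ary map takes its n arguments as a finite function; an element of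
   Hom(/\^n g, g) is such a map satisfying [alt_multilinear] below. *)
Definition nary (n : nat) := {ffun 'I_n -> g} -> g.

Definition set_arg (n : nat) (x : {ffun 'I_n -> g}) (i : 'I_n) (u : g) :
    {ffun 'I_n -> g} :=
  [ffun j => if j == i then u else x j].

Definition alt_multilinear (n : nat) (f : nary n) : Prop :=
  (forall (x : {ffun 'I_n -> g}) (i : 'I_n),
      GRing.linear_for *:%R (fun u => f (set_arg x i u))) /\
  (forall (x : {ffun 'I_n -> g}) (i j : 'I_n), i != j -> x i = x j -> f x = 0).

(* The n arguments (x_1, .., x_i omitted, .., x_(n+1)). *)
Definition omit (n : nat) (x : {ffun 'I_n.+1 -> g}) (i : 'I_n.+1) :
    {ffun 'I_n -> g} :=
  [ffun l => x (lift i l)].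

(* The n arguments (v, x_1, .., x_i omitted, .., x_j omitted, .., x_(n+1)),
   for i <> j. *)
Definition cons_omit2 (n : nat) (v : g) (x : {ffun 'I_n.+1 -> g})
    (i j : 'I_n.+1) : {ffun 'I_n -> g} :=
  [ffun l : 'I_n =>
     nth 0 (v :: [seq x h | h <- enum 'I_n.+1 & (h != i) && (h != j)]) l].

(* (p, n - p)-shuffles, as permutations of the n (0-based) positions. *)
Definition shuffle (n p : nat) (tau : 'S_n) : bool :=
  [forall a : 'I_n, forall b : 'I_n,
     (a < b)%N && ((b < p)%N || (p <= a)%N) ==> (tau a < tau b)%N].

(* (T x_tau(1), .., T x_tau(p), x_tau(p+1), .., x_tau(n)) *)
Definition shuffle_args (n p : nat) (T : g -> g) (tau : 'S_n)
    (x : {ffun 'I_n -> g}) : {ffun 'I_n -> g} :=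
  [ffun l : 'I_n => if (l < p)%N then T (x (tau l)) else x (tau l)].

Variables (mu lambda : k).

(* The pair (B_n, B_(n+1)). *)
Fixpoint Bpair (n : nat) : k * k :=
  if n is m.+1 then
    let: (b0, b1) := Bpair m in (b1, mu * b1 - lambda * b0)
  else (0, 1).

Definition Bconst (n : nat) : k := (Bpair n).1.

(* A_n is only used for n >= -1; the value below -1 is irrelevant. *)
Definition Aconst (n : int) : k :=
  if n is Posz m then lambda * Bconst m else -1.

Variables (br : g -> g -> g) (T : g -> g).

(* Indices i, j are 0-based here, whence the successors in the signs. *)
Definition dLie (n : nat) (f : nary n) : nary n.+1 := fun x =>
  \sum_(i < n.+1) (-1) ^+ (i.+1 + n) *: br (x i) (f (omit x i)) +
  \sum_(i < n.+1) \sum_(j < n.+1 | (i < j)%N)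
    (-1) ^+ (i.+1 + j.+1 + n.+1) *: f (cons_omit2 (br (x i) (x j)) x i j).

Definition dRB (n : nat) (f : nary n) : nary n.+1 := fun x =>
  \sum_(i < n.+1) (-1) ^+ (i.+1 + n) *:
    (br (T (x i)) (f (omit x i)) - T (br (x i) (f (omit x i)))) +
  \sum_(i < n.+1) \sum_(j < n.+1 | (i < j)%N)
    (-1) ^+ (i.+1 + j.+1 + n.+1) *:
      f (cons_omit2 (br (T (x i)) (x j) + br (x i) (T (x j))
                       + mu *: br (x i) (x j)) x i j).

Definition delta (n : nat) (f : nary n) : nary n := fun x =>
  - (\sum_(0 <= p < n.+1) \sum_(tau : 'S_n | shuffle p tau)
      ((-1) ^+ tau * Aconst (n%:Z - p%:Z - 1)) *: f (shuffle_args p T tau x))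
  - (\sum_(1 <= p < n.+1) \sum_(tau : 'S_n | shuffle p.-1 tau)
      ((-1) ^+ tau * Bconst (n - p + 1)%N) *:
         T (f (shuffle_args p.-1 T tau x))).

(* In degree 0 the second summand Hom(/\^(-1) g, g) is zero and is dropped. *)
Definition cochain (n : nat) : Type :=
  if n is m.+1 then (nary m.+1 * nary m)%type else nary 0.

Definition is_cochain (n : nat) : cochain n -> Prop :=
  match n return cochain n -> Prop with
  | 0 => fun f => alt_multilinear f
  | m.+1 => fun c => alt_multilinear c.1 /\ alt_multilinear c.2
  end.

Definition dRBA (n : nat) : cochain n -> cochain n.+1 :=
  match n return cochain n -> cochain n.+1 with
  | 0 => fun f => (dLie f, fun x => - delta f x)
  | m.+1 => fun c => (dLie c.1, fun x => - dRB c.2 x - delta c.1 x)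
  end.

Definition cochain_eq (n : nat) : cochain n -> cochain n -> Prop :=
  match n return cochain n -> cochain n -> Prop with
  | 0 => fun f f' => f =1 f'
  | m.+1 => fun c c' => c.1 =1 c'.1 /\ c.2 =1 c'.2
  end.

Definition cochain0 (n : nat) : cochain n :=
  match n return cochain n with
  | 0 => fun=> 0
  | m.+1 => (fun=> 0, fun=> 0)
  end.

Definition is_cocycle (n : nat) (c : cochain n) : Prop :=
  is_cochain c /\ cochain_eq (dRBA c) (cochain0 n.+1).

Definition is_coboundary (n : nat) : cochain n -> Prop :=
  match n return cochain n -> Prop with
  | 0 => fun c => cochain_eq c (cochain0 0)
  | m.+1 => fun c =>
      exists2 b : cochain m, is_cochain b & cochain_eq c (dRBA b)
  end.

(* H^n = Ker / Im is zero. *)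
Definition cohomology_vanishes (n : nat) : Prop :=
  forall c : cochain n, is_cocycle c -> is_coboundary c.

End Cohomology.

(* Formal power series \sum_n (a n) t^n with coefficients in V. *)
Definition fps (V : Type) : Type := nat -> V.

HB.instance Definition _ (V : zmodType) := GRing.Zmodule.copy (fps V) (nat -> V).

Lemma triangular_sumA (V : zmodType) (F : nat -> nat -> nat -> V) (n : nat) :
  \sum_(i < n.+1) \sum_(j < (n - i).+1) F i j (n - i - j)%N =
  \sum_(i < n.+1) \sum_(j < i.+1) F j (i - j)%N (n - i)%N.
Proof.
transitivity (\sum_(i < n.+1) \sum_(j < n.+1 | (i <= j)%N) F i (j - i)%N (n - j)%N).
  apply: eq_bigr => i _; have le_i : (i <= n)%N by rewrite -ltnS.
  have e : \sum_(0 + i <= j < n.+1) F i (j - i)%N (n - j)%N =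
           \sum_(0 <= j < (n - i).+1) F i j (n - i - j)%N.
    rewrite big_addn subSn //; apply: eq_bigr => j _.
    by rewrite addnK addnC subnDA.
  rewrite -(big_mkord xpredT (fun j => F i j (n - i - j)%N)) -e add0n.
  rewrite (big_nat_widenl i 0) //.
  by rewrite (big_mkord (fun j => true && (i <= j)%N) (fun j => F i (j - i)%N (n - j)%N)).
rewrite (exchange_big_dep xpredT) //=; apply: eq_bigr => i _.
rewrite -(big_mkord xpredT (fun j => F j (i - j)%N (n - i)%N)).
rewrite (big_nat_widen _ _ n.+1) ?ltn_ord // big_mkord.
by apply: eq_bigl => j; rewrite ltnS.
Qed.

Section PowerSeriesRing.
Variable R : comNzRingType.

Definition fpsC (c : R) : fps R := fun n => if n is 0 then c else 0.

Definition fps_mul (a b : fps R) : fps R :=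
  fun n => \sum_(i < n.+1) a i * b (n - i)%N.

Lemma fps_mulA : associative fps_mul.
Proof.
move=> a b c; apply/funext => n; rewrite /fps_mul.
under eq_bigr do rewrite big_distrr /=.
rewrite (triangular_sumA (fun i j l => a i * (b j * c l))).
apply: eq_bigr => i _; rewrite big_distrl /=.
by apply: eq_bigr => j _; rewrite mulrA.
Qed.

Lemma fps_mulC : commutative fps_mul.
Proof.
move=> a b; apply/funext => n; rewrite /fps_mul (reindex_inj rev_ord_inj) /=.
by apply: eq_bigr => i _; rewrite subSS subKn -1?ltnS // mulrC.
Qed.

Lemma fps_mul1 : left_id (fpsC 1) fps_mul.
Proof.
move=> a; apply/funext => n; rewrite /fps_mul big_ord_recl /= mul1r subn0.
by rewrite big1 ?addr0 // => i _; rewrite mul0r.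
Qed.

Lemma fps_mulDl : left_distributive fps_mul +%R.
Proof.
move=> a b c; apply/funext => n.
rewrite -[RHS]/(fps_mul a c n + fps_mul b c n) /fps_mul -big_split.
by apply: eq_bigr => i _; exact: mulrDl.
Qed.

Lemma fps_oner_neq0 : fpsC 1 != 0.
Proof. by apply/eqP => /(congr1 (@^~ 0%N)) /eqP; rewrite /= oner_eq0. Qed.

HB.instance Definition _ := GRing.Zmodule_isComNzRing.Build (fps R)
  fps_mulA fps_mulC fps_mul1 fps_mulDl fps_oner_neq0.

Variable V : lmodType R.

Definition fps_scale (a : fps R) (v : fps V) : fps V :=
  fun n => \sum_(i < n.+1) a i *: v (n - i)%N.

Lemma fps_scaleA a b v : fps_scale a (fps_scale b v) = fps_scale (a * b) v.
Proof.
apply/funext => n; rewrite /fps_scale.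
under eq_bigr do rewrite scaler_sumr.
rewrite (triangular_sumA (fun i j l => a i *: (b j *: v l))).
apply: eq_bigr => i _; rewrite scaler_suml.
by apply: eq_bigr => j _; rewrite scalerA.
Qed.

Lemma fps_scale1 : left_id (1 : fps R) fps_scale.
Proof.
move=> v; apply/funext => n; rewrite /fps_scale big_ord_recl scale1r subn0.
by rewrite big1 ?addr0 // => i _; rewrite scale0r.
Qed.

Lemma fps_scaleDr : right_distributive fps_scale +%R.
Proof.
move=> a v w; apply/funext => n.
rewrite -[RHS]/(fps_scale a v n + fps_scale a w n) /fps_scale -big_split.
by apply: eq_bigr => i _; exact: scalerDr.
Qed.

Lemma fps_scaleDl v : {morph fps_scale^~ v : a b / a + b}.
Proof.
move=> a b; apply/funext => n.
rewrite -[RHS]/(fps_scale a v n + fps_scale b v n) /fps_scale -big_split.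
by apply: eq_bigr => i _; exact: scalerDl.
Qed.

HB.instance Definition _ := GRing.Zmodule_isLmodule.Build (fps R) (fps V)
  fps_scaleA fps_scale1 fps_scaleDr fps_scaleDl.

End PowerSeriesRing.

Section Deformations.
Variables (k : fieldType) (g : lmodType k).

(* The t-linear extensions to g[[t]] of \sum_i (phi i) t^i and
   \sum_i (m i) t^i, for phi i linear and m i bilinear on g. *)
Definition fps_lin (phi : nat -> g -> g) (a : fps g) : fps g :=
  fun n => \sum_(i < n.+1) phi i (a (n - i)%N).

Definition fps_bilin (m : nat -> g -> g -> g) (a b : fps g) : fps g :=
  fun n => \sum_(i < n.+1) \sum_(j < (n - i).+1) m i (a j) (b (n - i - j)%N).

Variables (mu lambda : k) (br : g -> g -> g) (T : g -> g).

Definition is_deformation (m : nat -> g -> g -> g) (Tt : nat -> g -> g) : Prop :=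
  [/\ forall i, bilinear_for *:%R *:%R (m i) /\ (forall x, m i x x = 0),
      forall i, GRing.linear_for *:%R (Tt i),
      m 0%N =2 br,
      Tt 0%N =1 T
    & is_erb_lie (fpsC mu) (fpsC lambda) (fps_bilin m) (fps_lin Tt)].

Definition equivalent_deformations
    (m : nat -> g -> g -> g) (Tt : nat -> g -> g)
    (m' : nat -> g -> g -> g) (Tt' : nat -> g -> g) : Prop :=
  exists psi : nat -> g -> g,
    [/\ forall i, GRing.linear_for *:%R (psi i),
        psi 0%N =1 id,
        forall a b : fps g, fps_lin psi (fps_bilin m' a b) =
                            fps_bilin m (fps_lin psi a) (fps_lin psi b)
      & forall a : fps g, fps_lin psi (fps_lin Tt' a) =
                          fps_lin Tt (fps_lin psi a)].

Definition const_bracket : nat -> g -> g -> g :=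
  fun i => if i is 0 then br else fun _ _ => 0.

Definition const_operator : nat -> g -> g :=
  fun i => if i is 0 then T else fun _ => 0.

Definition rigid : Prop :=
  forall (m : nat -> g -> g -> g) (Tt : nat -> g -> g),
    is_deformation m Tt ->
    equivalent_deformations m Tt const_bracket const_operator.

End Deformations.

(* Main.v *)
Require Import Defs.
From HB Require Import structures.
From mathcomp Require Import all_boot all_fingroup all_algebra.
From mathcomp Require Import boolp functions.

Import GRing.Theory.
Local Open Scope ring_scope.

(* A trivialisation is a power series psi with m(psi x, psi y) = psi [x, y] and
   Tt (psi x) = psi (T x); it is found one coefficient at a time.  If psi works
   below order N, let E(x, y) and F(x) be the order-N coefficients of
   m(psi x, psi y) - psi [x, y] and Tt (psi x) - psi (T x).  Reading the Jacobi
   and Rota-Baxter identities of the deformation at psi x, psi y, psi z in order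
   N shows that (E, F) is a 2-cocycle, so it is the coboundary of some linear f,
   and replacing psi_N by psi_N - f makes psi work in order N as well.  Working
   with psi in this direction avoids inverting power series. *)

Set Implicit Arguments.
Unset Strict Implicit.

(* Moves each subtracted atom next to an added copy of it and cancels the pair;
   loops if an atom occurs twice with the same sign. *)
Ltac zmod_eq :=
  apply: subr0_eq; rewrite -[LHS]add0r;
  rewrite ?(scalerDr, scalerN, opprD, opprK, oppr0, addr0, addrA);
  repeat match goal with
  | |- context [_ - ?x] =>
      rewrite ?(addrAC _ x) ?(addrAC _ (- x)) (addrK, addrNK)
  end;
  reflexivity.

(** * Bundling linear and bilinear maps, so that the algebraic rewriting rules apply *)

Lemma linear_forP (R : nzRingType) (U V : lmodType R) (f : U -> V) :
  GRing.linear_for *:%R f -> exists F : {linear U -> V}, F = f :> (U -> V).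
Proof.
by move=> lin_f; exists (HB.pack_for {linear U -> V} f
  (GRing.isLinear.Build R U V _ f lin_f)).
Qed.

Lemma bilinear_forP (R : nzRingType) (U U' V : lmodType R) (f : U -> U' -> V) :
  bilinear_for *:%R *:%R f ->
  exists F : {bilinear U -> U' -> V}, F = f :> (U -> U' -> V).
Proof.
move=> bil_f.
by exists (HB.pack_for {bilinear U -> U' -> V} f
  (bilinear_isBilinear.Build R U U' V _ _ f bil_f)).
Qed.

Lemma linear_familyP (R : nzRingType) (U V : lmodType R) (f : nat -> U -> V) :
  (forall i, GRing.linear_for *:%R (f i)) ->
  exists F : nat -> {linear U -> V}, f = fun i => F i.
Proof.
move=> /(fun H i => linear_forP (H i))/choice[F eqF].
by exists F; apply/funext => i; rewrite eqF.
Qed.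

Lemma bilinear_familyP (R : nzRingType) (U U' V : lmodType R)
    (f : nat -> U -> U' -> V) :
  (forall i, bilinear_for *:%R *:%R (f i)) ->
  exists F : nat -> {bilinear U -> U' -> V}, f = fun i => F i.
Proof.
move=> /(fun H i => bilinear_forP (H i))/choice[F eqF].
by exists F; apply/funext => i; rewrite eqF.
Qed.

(** * Calculus of t-linear extensions to [g[[t]]] *)

Section FormalExtensions.
Variables (k : fieldType) (g : lmodType k).
Implicit Types (a b c : fps g) (x y : g).

Definition fps_const x : fps g := fun n => if n is 0 then x else 0.

(** Multiplication by [t]. *)
Definition fps_shift a : fps g := fun n => if n is n'.+1 then a n' else 0.

Lemma fpsDE a b n : (a + b) n = a n + b n. Proof. by []. Qed.

Lemma fps_const_shift a : a = fps_const (a 0%N) + fps_shift (fun n => a n.+1).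
Proof.
apply/funext => -[|n]; rewrite fpsDE /=; first by rewrite addr0.
by rewrite add0r.
Qed.

(** A light substitute for [k[[t]]]-linearity under which the values on constants already determine
    the map. *)
Definition t_linear (F : fps g -> fps g) :=
  (forall a b, F (a + b) = F a + F b) /\
  (forall a, F (fps_shift a) = fps_shift (F a)).

(** Induction on the coefficient: writing [a] as a constant plus [t] times a series, coefficient
    [n + 1] of the image of the second part is coefficient [n] of the image of that series. *)
Lemma t_linear_ext F G : t_linear F -> t_linear G ->
  (forall x, F (fps_const x) = G (fps_const x)) -> F = G.
Proof.
move=> [FD Ft] [GD Gt] FG.
suff eqFG n a : F a n = G a n by apply/funext => a; apply/funext => n.
elim: n a => [|n IHn] a; rewrite [a]fps_const_shift FD GD Ft Gt FG.
  by rewrite !fpsDE.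
by rewrite !fpsDE /= IHn.
Qed.

Lemma t_linear_comp F G : t_linear F -> t_linear G -> t_linear (F \o G).
Proof.
by move=> [FD Ft] [GD Gt]; split=> [a b|a] /=; rewrite ?GD ?FD ?Gt ?Ft.
Qed.

Section Linear.
Variable phi : nat -> {linear g -> g}.

Lemma fps_linE a n : fps_lin phi a n = \sum_(i < n.+1) phi i (a (n - i)%N).
Proof. by []. Qed.

Lemma t_linear_lin : t_linear (fps_lin phi).
Proof.
split=> [a b|a]; apply/funext => n.
  rewrite !fpsDE !fps_linE -big_split; apply: eq_bigr => i _.
  by rewrite fpsDE linearD.
rewrite fps_linE big_ord_recr /= subnn /= linear0 addr0.
case: n => [|n]; first by rewrite big_ord0.
by apply: eq_bigr => i _; rewrite subSn // -ltnS.
Qed.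

Lemma fps_lin_const x : fps_lin phi (fps_const x) = phi^~ x.
Proof.
apply/funext => n; rewrite fps_linE big_ord_recr /= subnn big1 ?add0r //.
move=> i _; have: (0 < n - i)%N by rewrite subn_gt0.
by case: (n - i)%N => //= _ _; rewrite linear0.
Qed.

Lemma fps_lin_congr a b n : (forall i, (i <= n)%N -> a i = b i) ->
  fps_lin phi a n = fps_lin phi b n.
Proof. by move=> ab; apply: eq_bigr => i _; rewrite ab ?leq_subr. Qed.

(** In order [n] the coefficient [a n] is met only by [phi 0]. This isolates the effect of altering
    a series in its top order. *)
Lemma fps_lin_top a b n : (forall i, (i < n)%N -> a i = b i) ->
  fps_lin phi a n = fps_lin phi b n + phi 0%N (a n - b n).
Proof.
move=> ab; rewrite !fps_linE !big_ord_recl /= subn0 linearB.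
rewrite (eq_bigr (fun i : 'I_n => phi (lift ord0 i) (b (n - lift ord0 i)%N))).
  by zmod_eq.
by move=> i _; rewrite ab // ltn_subrL (leq_ltn_trans _ (ltn_ord i)).
Qed.

End Linear.

Section Bilinear.
Variable m : nat -> {bilinear g -> g -> g}.

Lemma fps_bilinE a b n : fps_bilin m a b n =
  \sum_(i < n.+1) \sum_(j < (n - i).+1) m i (a j) (b (n - i - j)%N).
Proof. by []. Qed.

Lemma t_linear_bilinr a : t_linear (fps_bilin m a).
Proof.
split=> [b c|b]; apply/funext => n.
  rewrite !fpsDE !fps_bilinE -big_split; apply: eq_bigr => i _.
  rewrite -big_split; apply: eq_bigr => j _.
  by rewrite fpsDE linearDr.
rewrite fps_bilinE big_ord_recr /= subnn big_ord1 linear0r addr0.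
case: n => [|n]; first by rewrite big_ord0.
apply: eq_bigr => i _; have le_in : (i <= n)%N by rewrite -ltnS.
rewrite big_ord_recr /= subnn /= linear0r addr0 subSn //.
by apply: eq_bigr => j _; rewrite subSn // -ltnS.
Qed.

Lemma t_linear_bilinl b : t_linear (fps_bilin m ^~ b).
Proof.
split=> [a c|a]; apply/funext => n.
  rewrite !fpsDE !fps_bilinE -big_split; apply: eq_bigr => i _.
  rewrite -big_split; apply: eq_bigr => j _.
  by rewrite fpsDE linearDl.
rewrite fps_bilinE big_ord_recr /= subnn big_ord1 linear0l addr0.
case: n => [|n]; first by rewrite big_ord0.
apply: eq_bigr => i _; have le_in : (i <= n)%N by rewrite -ltnS.
rewrite big_ord_recl /= linear0l add0r subSn //.
Qed.

Lemma fps_bilin_congr a a' b b' n :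
    (forall i, (i <= n)%N -> a i = a' i) ->
    (forall i, (i <= n)%N -> b i = b' i) ->
  fps_bilin m a b n = fps_bilin m a' b' n.
Proof.
move=> eqa eqb; apply: eq_bigr => i _; apply: eq_bigr => j _.
rewrite eqa ?eqb // -?subnDA ?leq_subr //.
by rewrite (leq_trans (n := n - i)) ?leq_subr // -ltnS.
Qed.

Lemma fps_bilin_topr a b c n : (forall i, (i < n)%N -> b i = c i) ->
  fps_bilin m a b n = fps_bilin m a c n + m 0%N (a 0%N) (b n - c n).
Proof.
move=> bc; rewrite !fps_bilinE !big_ord_recl /= !subn0.
(* [S] gathers the rows [i > 0] and, below, [Q] the entries [j > 0] of row 0; both read [b] strictly
   below order [n]. *)
set S := (X in _ + X = _); set S' := (X in _ = _ + _ + X + _).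
have -> : S = S'.
  apply: eq_bigr => i _; apply: eq_bigr => j _; rewrite bc //.
  by rewrite (leq_ltn_trans (leq_subr _ _)) //
    ltn_subrL (leq_ltn_trans _ (ltn_ord i)).
rewrite linearBr.
set Q := \sum_(i < n) _; set Q' := \sum_(i < n) _.
have -> : Q = Q'.
  by apply: eq_bigr => j _; rewrite bc //
    ltn_subrL (leq_ltn_trans _ (ltn_ord j)).
by zmod_eq.
Qed.

Lemma fps_bilin_topl a b c n : (forall i, (i < n)%N -> a i = b i) ->
  fps_bilin m a c n = fps_bilin m b c n + m 0%N (a n - b n) (c 0%N).
Proof.
move=> ab; rewrite !fps_bilinE !(big_ord_recl n) /= !subn0.
set S := (X in _ + X = _); set S' := (X in _ = _ + X + _).
have -> : S = S'.
  apply: eq_bigr => i _; apply: eq_bigr => j _; rewrite ab //.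
  rewrite (leq_trans (ltn_ord j)) // ltn_subrL.
  by rewrite (leq_ltn_trans _ (ltn_ord i)).
(* On this side the sensitive entry of row 0 is the last one, [j = n], so it is split off from the
   right. *)
rewrite !(big_ord_recr n) /= subnn linearBl.
set Q := \sum_(i < n) _; set Q' := \sum_(i < n) _.
have -> : Q = Q' by apply: eq_bigr => j _; rewrite ab.
by zmod_eq.
Qed.

End Bilinear.

Lemma fpsC_scaleE (r : k) a n : (fpsC r *: a) n = r *: a n.
Proof.
rewrite -[LHS]/(\sum_(i < n.+1) fpsC r i *: a (n - i)%N) big_ord_recl subn0.
by rewrite big1 ?addr0 // => i _; rewrite scale0r.
Qed.

End FormalExtensions.

(** * The two-element index set and its permutations *)

Lemma ord2_cases (i : 'I_2) : i = ord0 \/ i = ord_max.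
Proof. by case: i => [[|[|]]] // lt_i2; [left | right]; exact: val_inj. Qed.

Lemma perm2_cases (s : 'S_2) : s = 1%g \/ s = tperm ord0 ord_max.
Proof.
have := @perm_inj _ s ord0 ord_max.
have [s0|s0] := ord2_cases (s ord0); have [s1|s1] := ord2_cases (s ord_max);
  rewrite s0 s1 => s_inj.
- by have := s_inj erefl.
- by left; apply/permP => i; rewrite perm1; case: (ord2_cases i) => ->.
- right; apply/permP => i.
  by case: (ord2_cases i) => ->; rewrite ?tpermL ?tpermR.
- by have := s_inj erefl.
Qed.

Lemma big_perm2 (V : zmodType) (P : pred 'S_2) (F : 'S_2 -> V) :
  \sum_(s | P s) F s =
  (if P 1%g then F 1%g else 0) +
  (if P (tperm ord0 ord_max) then F (tperm ord0 ord_max) else 0).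
Proof.
have t_neq1 : tperm ord0 ord_max != 1%g :> 'S_2.
  by apply/eqP => /permP/(_ ord0); rewrite tpermL perm1.
rewrite big_mkcond (bigD1 1%g) //= (bigD1 (tperm ord0 ord_max)) //=.
rewrite [X in _ + (_ + X)]big1 ?addr0 // => s /andP[s1 st].
by case: (perm2_cases s) s1 st => ->; rewrite eqxx.
Qed.

(** * The differentials around degree 2 in closed form *)

Section LowDegrees.
Variables (k : fieldType) (g : lmodType k) (mu lambda : k).
Variables (br : {bilinear g -> g -> g}) (T : {linear g -> g}).

Let i0 := @Ordinal 3 0 isT.
Let i1 := @Ordinal 3 1 isT.
Let i2 := @Ordinal 3 2 isT.

Definition nary1 (F : g -> g) : nary g 1 := fun v => F (v ord0).

Definition nary2 (E : g -> g -> g) : nary g 2 :=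
  fun v => E (v ord0) (v ord_max).

Definition args2 (x y : g) : {ffun 'I_2 -> g} :=
  [ffun i => if i == ord0 then x else y].

Lemma enum_ord3 : enum 'I_3 = [:: i0; i1; i2].
Proof. by apply: (inj_map val_inj); rewrite val_enum_ord. Qed.

Lemma sum_lt_ord2 (V : zmodType) (F : 'I_2 -> 'I_2 -> V) :
  \sum_(i < 2) \sum_(j < 2 | (i < j)%N) F i j = F ord0 ord_max.
Proof.
under eq_bigr do rewrite big_mkcond !big_ord_recl big_ord0 /=.
rewrite !big_ord_recl big_ord0 /= !addr0 add0r.
by congr (F _ _); exact: val_inj.
Qed.

Lemma sum_ord3 (V : zmodType) (F : 'I_3 -> V) :
  \sum_(i < 3) F i = F i0 + F i1 + F i2.
Proof.
rewrite !big_ord_recl big_ord0 addr0 addrA.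
by congr (F _ + F _ + F _); exact: val_inj.
Qed.

Lemma sum_lt_ord3 (V : zmodType) (F : 'I_3 -> 'I_3 -> V) :
  \sum_(i < 3) \sum_(j < 3 | (i < j)%N) F i j = F i0 i1 + F i0 i2 + F i1 i2.
Proof.
under eq_bigr do rewrite big_mkcond sum_ord3.
by rewrite sum_ord3 /= !addr0 !add0r.
Qed.

Lemma signrE (R : pzRingType) n : (-1) ^+ n = (if odd n then -1 else 1) :> R.
Proof. by rewrite -signr_odd; case: (odd n). Qed.

(** ['I_0] is empty, so all argument families on it coincide and a 0-cochain amounts to one vector
    of [g]. *)
Lemma nary0_const (f : nary g 0) v w : f v = f w.
Proof. by congr f; apply/ffunP => -[]. Qed.

Lemma dLie1 (F : g -> g) v : dLie br (nary1 F) v =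
  br (v ord0) (F (v ord_max)) - br (v ord_max) (F (v ord0))
  - F (br (v ord0) (v ord_max)).
Proof.
have e1 : lift ord0 ord0 = ord_max :> 'I_2 by exact: val_inj.
have e0 : lift ord_max ord0 = ord0 :> 'I_2 by exact: val_inj.
rewrite /dLie /nary1 sum_lt_ord2 big_ord_recl big_ord1 !ffunE
  /= !e1 !e0 !signrE /=.
by rewrite scale1r !scaleN1r.
Qed.

Lemma dRB1 (G : g -> g) v : dRB mu br T (nary1 G) v =
  let x := v ord0 in let y := v ord_max in
  br (T x) (G y) - T (br x (G y)) - (br (T y) (G x) - T (br y (G x)))
  - G (br (T x) y + br x (T y) + mu *: br x y).
Proof.
have e1 : lift ord0 ord0 = ord_max :> 'I_2 by exact: val_inj.
have e0 : lift ord_max ord0 = ord0 :> 'I_2 by exact: val_inj.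
rewrite /dRB /nary1 sum_lt_ord2 big_ord_recl big_ord1 !ffunE
  /= !e1 !e0 !signrE /=.
by rewrite scale1r !scaleN1r.
Qed.

Lemma dRB0 (a : nary g 0) v : dRB mu br T a v =
  T (br (v ord0) (a [ffun=> 0])) - br (T (v ord0)) (a [ffun=> 0]).
Proof.
rewrite /dRB !big_ord1 big_mkcond big_ord1 /= addr0 expr1 scaleN1r opprB.
by rewrite (nary0_const a _ [ffun=> 0]).
Qed.

Lemma dLie2 (E : g -> g -> g) v : dLie br (nary2 E) v =
  let x := v i0 in let y := v i1 in let z := v i2 in
  - br x (E y z) + br y (E x z) - br z (E x y)
  + (E (br x y) z - E (br x z) y + E (br y z) x).
Proof.
have e00 : lift i0 ord0 = i1 by exact: val_inj.
have e01 : lift i0 ord_max = i2 by exact: val_inj.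
have e10 : lift i1 ord0 = i0 by exact: val_inj.
have e11 : lift i1 ord_max = i2 by exact: val_inj.
have e20 : lift i2 ord0 = i0 by exact: val_inj.
have e21 : lift i2 ord_max = i1 by exact: val_inj.
rewrite /dLie /nary2 sum_lt_ord3 sum_ord3 !ffunE enum_ord3 /=.
by rewrite e00 e01 e10 e11 e20 e21 !signrE /= !scale1r !scaleN1r.
Qed.

Lemma shuffle1 n p : shuffle p (1%g : 'S_n).
Proof.
by apply/forallP => a; apply/forallP => b; apply/implyP => /andP[];
  rewrite !perm1.
Qed.

(** For [p = 0] or [p >= 2] both positions lie in one block, whose order a shuffle preserves; only
    [p = 1] separates them. *)
Lemma shuffle_tperm2 p :
  shuffle p (tperm ord0 ord_max : 'S_2) = (0 < p <= 1)%N.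
Proof.
have [-> /=|p1] := eqVneq p 1%N.
  apply/forallP => a; apply/forallP => b.
  by case: (ord2_cases a) => ->; case: (ord2_cases b) => ->.
case: p p1 => [|[|p]] // _; apply/negbTE/negP;
  by move=> /forallP/(_ ord0)/forallP/(_ ord_max); rewrite tpermL tpermR.
Qed.

(** The constants involved are [A_0 = 0], [A_(-1) = -1] and [B_1 = 1]. *)
Lemma delta1 (F : g -> g) v :
  delta mu lambda T (nary1 F) v = F (T (v ord0)) - T (F (v ord0)).
Proof.
have perm1_eq (s : 'S_1) : s = 1%g by apply/permP => i; rewrite !ord1.
have sumS (V : zmodType) p (H : 'S_1 -> V) : \sum_(s | shuffle p s) H s = H 1%g.
  rewrite big_mkcond (bigD1 1%g) //= shuffle1 big1 ?addr0 // => s.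
  by rewrite (perm1_eq s) eqxx.
rewrite /delta /nary1 big_nat_recl // !big_nat1 !sumS odd_perm1 !ffunE
  !perm1 /=.
rewrite !expr0 !mul1r /Bconst /= mulr0 scale0r add0r scaleN1r opprK.
by rewrite scale1r.
Qed.

(** Here [A_1 = lambda], [A_0 = 0], [A_(-1) = -1], [B_2 = mu] and [B_1 = 1]; the vanishing [A_0]
    removes the mixed terms outside [T]. The sign of [E (T y) x] is that of the transposition, the
    only nontrivial (1,1)-shuffle. *)
Lemma delta2 (E : g -> g -> g) v : delta mu lambda T (nary2 E) v =
  let x := v ord0 in let y := v ord_max in
  E (T x) (T y) - lambda *: E x y - T (E (T x) y - E (T y) x + mu *: E x y).
Proof.
have sum03 (V : zmodType) (H : nat -> V) :
    \sum_(0 <= p < 3) H p = H 0%N + H 1%N + H 2%N.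
  by rewrite !big_nat_recr //= big_geq // add0r.
have sum13 (V : zmodType) (H : nat -> V) :
    \sum_(1 <= p < 3) H p = H 1%N + H 2%N.
  by rewrite big_nat_recr // big_nat1.
rewrite /delta /nary2 sum03 sum13 !big_perm2 !shuffle1 !shuffle_tperm2.
rewrite !ffunE !tpermL !tpermR !perm1 odd_perm1 odd_tperm /=.
rewrite ?(expr0, expr1) /Bconst /=.
rewrite ?(mul1r, mulr0, subr0, scale0r, addr0, add0r, mulr1).
rewrite scale1r !scaleN1r !(linearD T, linearN T, linearZZ T).
by zmod_eq.
Qed.

Lemma alt_multilinear_nary1 (F : {linear g -> g}) : alt_multilinear (nary1 F).
Proof.
split=> [v i a x y|v i j]; last by rewrite !ord1 eqxx.
by rewrite /nary1 !ffunE !ord1 eqxx linearP.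
Qed.

Lemma alt_multilinear_nary2 (E : {bilinear g -> g -> g}) :
  (forall x, E x x = 0) -> alt_multilinear (nary2 E).
Proof.
move=> Exx; split=> [v i a x y|v i j]; rewrite /nary2.
  rewrite !ffunE; case: (ord2_cases i) => -> /=.
    by rewrite linearPl.
  by rewrite linearPr.
case: (ord2_cases i) => ->; case: (ord2_cases j) => ->;
  rewrite ?eqxx // => _ ->.
  by rewrite Exx.
by rewrite Exx.
Qed.

Lemma alt_multilinear1P (f : nary g 1) :
  alt_multilinear f -> exists F : {linear g -> g}, f = nary1 F.
Proof.
move=> [lin_f _].
have arg1 v u : set_arg v ord0 u = [ffun=> u] :> {ffun 'I_1 -> g}.
  by apply/ffunP => i; rewrite !ffunE ord1.
have [|F eqF] := @linear_forP _ _ _ (fun u => f [ffun=> u]).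
  by move=> a x y; have := lin_f [ffun=> 0] ord0 a x y; rewrite !arg1.
exists F; apply/funext => v; rewrite /nary1 eqF; congr f.
by apply/ffunP => i; rewrite !ffunE ord1.
Qed.

Lemma alternating_skew (E : {bilinear g -> g -> g}) :
  (forall x, E x x = 0) -> forall x y, E y x = - E x y.
Proof.
move=> Exx x y; apply/esym/addr0_eq.
by have := Exx (x + y); rewrite linearDl !linearDr !Exx add0r addr0.
Qed.

Hypothesis brxx : forall x, br x x = 0.
Hypothesis jacobi :
  forall x y z, br x (br y z) + br y (br z x) + br z (br x y) = 0.

(* A 0-cochain [a] contributes to the coboundary exactly what the inner
   derivation [br a] does, so it is absorbed into the linear map. *)
Lemma cocycle2_split (E : {bilinear g -> g -> g}) (F : {linear g -> g}) :
    cohomology_vanishes mu lambda br T 2 ->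
    (forall x, E x x = 0) ->
    (forall x y z, br x (E y z) + br y (E z x) + br z (E x y) +
                   (E x (br y z) + E y (br z x) + E z (br x y)) = 0) ->
    (forall x y, E (T x) (T y) + br (F x) (T y) + br (T x) (F y) =
       F (br (T x) y + br x (T y) + mu *: br x y) +
       T (E (T x) y + E x (T y) + br (F x) y + br x (F y) + mu *: E x y) +
       lambda *: E x y) ->
  exists f : {linear g -> g},
    (forall x y, E x y = br x (f y) + br (f x) y - f (br x y)) /\
    (forall x, F x = T (f x) - f (T x)).
Proof.
move=> H2 Exx jacE rbE.
have Eskew := alternating_skew Exx; have bskew := alternating_skew brxx.
have [|[b1 a] /= [/alt_multilinear1P[f0 ->{b1}] _] [/= eqE eqF]] :=
    H2 (nary2 E, nary1 F).
  split; first split.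
  - exact: alt_multilinear_nary2.
  - exact: alt_multilinear_nary1.
  split=> v /=; rewrite /cochain0.
    (* Skew-symmetry turns the Lie component into the negative of [jacE]. *)
    rewrite dLie2 /=.
    set x := v i0; set y := v i1; set z := v i2.
    rewrite -[RHS]oppr0 -(jacE x y z).
    rewrite (Eskew x z) linearNr (Eskew z (br x y)) (Eskew y (br x z)).
    rewrite (Eskew x (br y z)) (bskew x z) linearNr.
    by zmod_eq.
  rewrite dRB1 delta2 /=.
  set x := v ord0; set y := v ord_max.
  have := rbE x y; set w := br (T x) y + _ + _ => e.
  (* Solving [rbE] for [E (T x) (T y)] leaves only terms that cancel after expansion. *)
  have -> : E (T x) (T y) = F w +
     T (E (T x) y + E x (T y) + br (F x) y + br x (F y) + mu *: E x y) +
     lambda *: E x y - br (F x) (T y) - br (T x) (F y).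
    by rewrite -e; zmod_eq.
  rewrite (Eskew x (T y)) (bskew (F x) (T y)) (bskew (F x) y).
  rewrite !(linearD T, linearN T, linearZZ T).
  by zmod_eq.
pose c := a [ffun=> 0].
have [|f eqf] := @linear_forP _ _ _ (fun x => f0 x - br x c).
  by move=> r x y; rewrite linearPl linearP; zmod_eq.
exists f; rewrite eqf; split=> [x y|x].
  have := eqE (args2 x y); rewrite dLie1 /nary2 /args2 !ffunE /= => ->.
  rewrite linearBr linearBl (bskew (f0 x) y) (bskew c (br x y)).
  rewrite (bskew y (br x c)).
  (* The terms in [c] cancel: an inner derivation is a Lie cocycle, by Jacobi at [c], [x], [y]. *)
  have := jacobi c x y; rewrite (bskew x c) linearNr => e.
  by apply: subr0_eq; rewrite -[RHS]e; zmod_eq.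
have := eqF [ffun=> x]; rewrite dRB0 delta1 /nary1 !ffunE => ->.
by rewrite (linearB T) -/c; zmod_eq.
Qed.

End LowDegrees.

(** * Order-by-order construction of the trivialising series *)

Section Rigidity.
Variables (k : fieldType) (g : lmodType k) (mu lambda : k).
Variables (br : {bilinear g -> g -> g}) (T : {linear g -> g}).
Variables (m : nat -> {bilinear g -> g -> g}) (Tt : nat -> {linear g -> g}).

Hypothesis erb_br : is_erb_lie mu lambda br T.
Hypothesis m0 : m 0%N =2 br.
Hypothesis Tt0 : Tt 0%N =1 T.
Hypothesis erb_m :
  is_erb_lie (fpsC mu) (fpsC lambda) (fps_bilin m) (fps_lin Tt).
Hypothesis H2_eq0 : cohomology_vanishes mu lambda br T 2.

Implicit Types (psi : nat -> {linear g -> g}) (x y z : g).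

(** [psi^~ x] is the series [psi_t(x)] of a constant [x]; testing on constants suffices by
    t-linearity. *)
Definition intertwines_at psi i :=
  (forall x y, fps_bilin m (psi^~ x) (psi^~ y) i = psi i (br x y)) /\
  (forall x, fps_lin Tt (psi^~ x) i = psi i (T x)).

Definition intertwines_upto n psi :=
  psi 0%N =1 id /\ forall i, (i <= n)%N -> intertwines_at psi i.

(** * The first possibly nonzero defect is a 2-cocycle *)

Section Obstruction.
Variables (psi : nat -> {linear g -> g}) (n : nat).
Hypothesis psi_n : intertwines_upto n psi.

Let P x : fps g := psi^~ x.
Let E x y := fps_bilin m (P x) (P y) n.+1 - psi n.+1 (br x y).
Let F x := fps_lin Tt (P x) n.+1 - psi n.+1 (T x).

Let P0 x : P x 0%N = x. Proof. by case: psi_n => psi0 _; exact: psi0. Qed.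

Let bracketP x y i : (i < n.+1)%N -> fps_bilin m (P x) (P y) i = P (br x y) i.
Proof. by move=> lt_in; have [_ /(_ i lt_in)[->]] := psi_n. Qed.

Let operatorP x i : (i < n.+1)%N -> fps_lin Tt (P x) i = P (T x) i.
Proof. by move=> lt_in; have [_ /(_ i lt_in)[_ ->]] := psi_n. Qed.

Let bracketE x y : fps_bilin m (P x) (P y) n.+1 = psi n.+1 (br x y) + E x y.
Proof. by rewrite /E addrC addrNK. Qed.

Let operatorE x : fps_lin Tt (P x) n.+1 = psi n.+1 (T x) + F x.
Proof. by rewrite /F addrC addrNK. Qed.

Lemma obstruction_bilinear : bilinear_for *:%R *:%R E.
Proof.
split=> [y a x x'|x a y y']; rewrite /E !fps_bilinE.
  rewrite linearPl linearP.
  rewrite (eq_bigr (fun i : 'I_n.+2 =>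
      a *: \sum_(j < (n.+1 - i).+1) m i (P x j) (P y (n.+1 - i - j)%N) +
      \sum_(j < (n.+1 - i).+1) m i (P x' j) (P y (n.+1 - i - j)%N))).
    by rewrite big_split -scaler_sumr /=; zmod_eq.
  move=> i _; rewrite scaler_sumr -big_split; apply: eq_bigr => j _.
  by rewrite /P linearP linearPl.
rewrite linearPr linearP.
rewrite (eq_bigr (fun i : 'I_n.+2 =>
    a *: \sum_(j < (n.+1 - i).+1) m i (P x j) (P y (n.+1 - i - j)%N) +
    \sum_(j < (n.+1 - i).+1) m i (P x j) (P y' (n.+1 - i - j)%N))).
  by rewrite big_split -scaler_sumr /=; zmod_eq.
move=> i _; rewrite scaler_sumr -big_split; apply: eq_bigr => j _.
by rewrite /P linearP linearPr.
Qed.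

Lemma obstruction_linear : GRing.linear_for *:%R F.
Proof.
move=> a x y; rewrite /F !fps_linE !linearP.
rewrite (eq_bigr (fun i : 'I_n.+2 =>
    a *: Tt i (P x (n.+1 - i)%N) + Tt i (P y (n.+1 - i)%N))).
  by rewrite big_split -scaler_sumr /=; zmod_eq.
by move=> i _; rewrite /P !linearP.
Qed.

Lemma obstruction_alternating x : E x x = 0.
Proof.
have [[_ brxx _] _ _] := erb_br; have [[_ mxx _] _ _] := erb_m.
by rewrite /E mxx brxx linear0 subr0.
Qed.

Lemma obstruction_jacobi x y z :
  br x (E y z) + br y (E z x) + br z (E x y) +
  (E x (br y z) + E y (br z x) + E z (br x y)) = 0.
Proof.
have [[_ _ jacbr] _ _] := erb_br; have [[_ _ jacm] _ _] := erb_m.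
(* Below order [n + 1] the inner bracket equals [P (br v w)]; in that order it exceeds it by
   [E v w], which only [m 0 = br] carries into the outer bracket. *)
have nested u v w : fps_bilin m (P u) (fps_bilin m (P v) (P w)) n.+1 =
    psi n.+1 (br u (br v w)) + E u (br v w) + br u (E v w).
  rewrite (fps_bilin_topr _ _ (c := P (br v w))); last first.
    by move=> i; exact: bracketP.
  by rewrite bracketE P0 m0.
have /(congr1 (@^~ n.+1)) := jacm (P x) (P y) (P z).
rewrite !fpsDE !nested => e.
have ejac := congr1 (psi n.+1) (jacbr x y z).
rewrite !linearD linear0 in ejac.
(* The added sum is [psi n.+1] applied to the Jacobi identity of [br], hence zero; it completes the
   goal to [e]. *)
apply: (addrI (psi n.+1 (br x (br y z)) + psi n.+1 (br y (br z x)) +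
  psi n.+1 (br z (br x y)))).
by transitivity (0 : g); [rewrite -[RHS]e; zmod_eq | rewrite addr0 ejac].
Qed.

(** The Rota-Baxter identity at [P x], [P y] is expanded in order [n + 1]. The defects enter
    linearly, since a product of two of them would only appear from order [2n + 2] on. *)
Lemma obstruction_operator x y :
  E (T x) (T y) + br (F x) (T y) + br (T x) (F y) =
  F (br (T x) y + br x (T y) + mu *: br x y) +
  T (E (T x) y + E x (T y) + br (F x) y + br x (F y) + mu *: E x y) +
  lambda *: E x y.
Proof.
have [_ _ rbbr] := erb_br; have [_ _ rbm] := erb_m.
have bracketTl u v : fps_bilin m (fps_lin Tt (P u)) (P v) n.+1 =
    psi n.+1 (br (T u) v) + E (T u) v + br (F u) v.
  rewrite (fps_bilin_topl _ (b := P (T u))); last by move=> i; exact: operatorP.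
  by rewrite bracketE P0 m0.
have bracketTr u v : fps_bilin m (P u) (fps_lin Tt (P v)) n.+1 =
    psi n.+1 (br u (T v)) + E u (T v) + br u (F v).
  rewrite (fps_bilin_topr _ _ (c := P (T v))); last first.
    by move=> i; exact: operatorP.
  by rewrite bracketE P0 m0.
have bracketTT : fps_bilin m (fps_lin Tt (P x)) (fps_lin Tt (P y)) n.+1 =
    psi n.+1 (br (T x) (T y)) + E (T x) (T y) + br (T x) (F y) + br (F x) (T y).
  rewrite (fps_bilin_topl _ (b := P (T x))); last by move=> i; exact: operatorP.
  by rewrite bracketTr (operatorP y (ltn0Sn n)) P0 m0.
set w := br (T x) y + _ + _; set W := _ + mu *: E x y.
have /(congr1 (@^~ n.+1)) := rbm (P x) (P y).
rewrite bracketTT fpsDE fpsC_scaleE bracketE.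
(* Below order [n + 1] the argument of [Tt] on the right agrees with [P w], so the discrepancy in
   the top order is hit by [Tt 0 = T] alone. *)
rewrite (fps_lin_top _ (b := P w)) ?operatorE; last first.
  move=> i lt_in; rewrite !fpsDE fpsC_scaleE bracketP // /P !linearD linearZZ.
  congr (_ + _ + _).
    rewrite -[RHS](bracketP (T x) y lt_in).
    apply: fps_bilin_congr => // j le_ji.
    exact: operatorP (leq_ltn_trans le_ji lt_in).
  rewrite -[RHS](bracketP x (T y) lt_in); apply: fps_bilin_congr => // j le_ji.
  exact: operatorP (leq_ltn_trans le_ji lt_in).
rewrite !fpsDE fpsC_scaleE bracketTl bracketTr bracketE Tt0.
set V := (X in _ + T X + _).
(* Subtracting [P w] cancels every [psi n.+1] term and leaves the defects collected in [W]. *)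
have -> : V = W.
  by rewrite /V /W /P /w !(linearD (psi n.+1)) (linearZZ (psi n.+1)); zmod_eq.
rewrite rbbr -/w (linearD (psi n.+1)) (linearZZ (psi n.+1)) => e.
apply: (addrI (psi n.+1 (T w) + lambda *: psi n.+1 (br x y))).
by apply: etrans (etrans _ e) _; zmod_eq.
Qed.

End Obstruction.

Lemma intertwines_extend n psi : intertwines_upto n psi ->
  exists psi', (forall i, (i <= n)%N -> psi' i = psi i) /\
               intertwines_upto n.+1 psi'.
Proof.
move=> psi_n; have [psi0 psi_le] := psi_n.
have [[_ brxx jacbr] _ _] := erb_br.
have [E eqE] := bilinear_forP (obstruction_bilinear psi n).
have [F eqF] := linear_forP (obstruction_linear psi n).
have [|||f [fE fF]] := @cocycle2_split _ _ _ _ br T brxx jacbr E F H2_eq0.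
- by rewrite eqE; exact: obstruction_alternating.
- by rewrite eqE; exact: obstruction_jacobi.
- by rewrite eqE eqF; exact: obstruction_operator.
pose psi' i : {linear g -> g} :=
  if i == n.+1 then (psi i \- f : {linear g -> g}) else psi i.
have psi'E i : (i < n.+1)%N -> psi' i = psi i.
  by rewrite /psi' ltn_neqAle => /andP[/negbTE->].
have psi'N x : psi' n.+1 x - psi n.+1 x = - f x.
  by rewrite /psi' eqxx /= addrC addKr.
exists psi'; split=> //; split=> [x|i]; first by rewrite psi'E.
rewrite leq_eqVlt => /predU1P[-> | lt_in]; last first.
  have [bri Ti] := psi_le i lt_in.
  rewrite /intertwines_at psi'E //; split=> [x y|x].
    rewrite -bri; apply: fps_bilin_congr => j le_ji; rewrite psi'E //;
      exact: leq_ltn_trans lt_in.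
  rewrite -Ti; apply: fps_lin_congr => j le_ji; rewrite psi'E //.
  exact: leq_ltn_trans lt_in.
split=> [x y|x].
  (* By [fE], the change [- br (f x) y - br x (f y)] of the bracket turns the defect [E x y] into
     [- f (br x y)], which is the change of the right-hand side. *)
  rewrite (fps_bilin_topl _ (b := psi^~ x)); last by move=> j /psi'E ->.
  rewrite (fps_bilin_topr _ _ (c := psi^~ y)); last by move=> j /psi'E ->.
  rewrite !psi'N psi'E // !psi0 !m0 /psi' eqxx /=.
  have := fE x y; rewrite eqE => /(canRL (subrK _)) ->.
  by rewrite linearNr linearNl; zmod_eq.
rewrite (fps_lin_top _ (b := psi^~ x)); last by move=> j /psi'E ->.
rewrite psi'N Tt0 /psi' eqxx /=.
have := fF x; rewrite eqF => /(canRL (subrK _)) ->.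
by rewrite (linearN T); zmod_eq.
Qed.

Lemma intertwiner_exists :
  exists psi, psi 0%N =1 id /\ forall i, intertwines_at psi i.
Proof.
(* Only coefficient 0 matters at the start; the identities in higher orders are placeholders, each
   corrected at its own stage. *)
pose id_psi (_ : nat) : {linear g -> g} := idfun.
have base : intertwines_upto 0 id_psi.
  split=> // i; rewrite leqn0 => /eqP ->; split=> [x y|x].
    by rewrite fps_bilinE !big_ord1 m0.
  by rewrite fps_linE big_ord1 Tt0.
(* An extension exists only for a series that works up to order [n], so [next] decides this
   classically; the default [psi] is never reached along [s]. *)
pose next n psi : nat -> {linear g -> g} :=
  if pselect (intertwines_upto n psi) is left H
  then projT1 (cid (intertwines_extend H)) else psi.
pose s := fix s n := if n is n'.+1 then next n' (s n') else id_psi.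
have nextP n psi : intertwines_upto n psi ->
    (forall i, (i <= n)%N -> next n psi i = psi i) /\
    intertwines_upto n.+1 (next n psi).
  by rewrite /next; case: pselect => // H _; case: cid.
have sP n : intertwines_upto n (s n).
  by elim: n => // n IHn; case: (nextP _ _ IHn).
have sE n i : (i <= n)%N -> s n i = s i i.
  elim: n => [|n IHn]; first by rewrite leqn0 => /eqP ->.
  rewrite leq_eqVlt => /predU1P[-> // | lt_in].
  by rewrite -IHn //; have [sS _] := nextP _ _ (sP n); exact: sS.
(* The diagonal is the limit: by [sE], coefficient [i] is frozen from stage [i] on. *)
exists (fun i => s i i); split; first by case: base.
move=> i; have [_ /(_ i (leqnn i))[bri Ti]] := sP i; split=> [x y|x].
  by rewrite -bri; apply: fps_bilin_congr => j le_ji; rewrite sE.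
by rewrite -Ti; apply: fps_lin_congr => j le_ji; rewrite sE.
Qed.

(** Both sides of each intertwining identity are t-linear in every variable, so agreement on
    constants extends to [g[[t]]]. *)
Lemma deformation_trivial :
  equivalent_deformations m Tt (const_bracket br) (const_operator T).
Proof.
have [psi [psi0 psiP]] := intertwiner_exists.
have [cb eq_cb] : exists c : nat -> {bilinear g -> g -> g},
    const_bracket br = fun i => c i.
  apply: bilinear_familyP => -[|i].
    by split=> [x a y z|x a y z] /=; rewrite (linearPl, linearPr).
  by split=> x a y z /=; rewrite scaler0 addr0.
have [ct eq_ct] : exists c : nat -> {linear g -> g},
    const_operator T = fun i => c i.
  by apply: linear_familyP => -[|i] a x y /=; rewrite ?linearP // scaler0 addr0.
have constB x y : fps_bilin (const_bracket br) (fps_const x) (fps_const y) =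
                  fps_const (br x y).
  apply/funext => -[|n]; rewrite /fps_bilin; first by rewrite !big_ord1.
  rewrite big1 // => -[[|i] lt_i] _; rewrite big1 //= => -[[|j] lt_j] _ /=.
    by rewrite linear0r.
  by rewrite linear0l.
have constT x : fps_lin (const_operator T) (fps_const x) = fps_const (T x).
  apply/funext => -[|n]; rewrite /fps_lin; first by rewrite big_ord1.
  by rewrite big1 // => -[[|i] lt_i] _ //=; rewrite linear0.
exists (fun i => psi i); split=> [i|//|a b|a].
- exact: linearP.
(* Extensionality is applied once per variable: [eqB] lets the second argument vary over a constant
   first one, then the first varies with [b] fixed. *)
- suff eqB c :
    (fun b => fps_lin psi (fps_bilin (const_bracket br) (fps_const c) b))
      = (fun b => fps_bilin m (fps_lin psi (fps_const c)) (fps_lin psi b)).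
    suff /(congr1 (@^~ a)) :
      (fun a => fps_lin psi (fps_bilin (const_bracket br) a b))
        = (fun a => fps_bilin m (fps_lin psi a) (fps_lin psi b)) by [].
    apply: t_linear_ext => [||x]; last exact: (congr1 (@^~ b) (eqB x)).
      rewrite eq_cb.
      exact: t_linear_comp (t_linear_lin psi) (t_linear_bilinl cb b).
    exact: t_linear_comp (t_linear_bilinl m _) (t_linear_lin psi).
  apply: t_linear_ext => [||x].
  + rewrite eq_cb.
    exact: t_linear_comp (t_linear_lin psi) (t_linear_bilinr cb _).
  + exact: t_linear_comp (t_linear_bilinr m _) (t_linear_lin psi).
  rewrite constB !fps_lin_const; apply/funext => i.
  by have [-> _] := psiP i.
- suff /(congr1 (@^~ a)) : fps_lin psi \o fps_lin (const_operator T) =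
      fps_lin Tt \o fps_lin psi by [].
  apply: t_linear_ext => [||x] /=.
  + rewrite eq_ct; exact: t_linear_comp (t_linear_lin psi) (t_linear_lin ct).
  + exact: t_linear_comp (t_linear_lin Tt) (t_linear_lin psi).
  rewrite constT !fps_lin_const; apply/funext => i.
  by have [_ ->] := psiP i.
Qed.

End Rigidity.

Unset Implicit Arguments.

Theorem theorem7p7 (k : fieldType) (hchar : [pchar k] =i pred0)
    (mu lambda : k) (hsqrt : exists r : k, r ^+ 2 = mu ^+ 2 - 4%:R * lambda)
    (g : lmodType k) (br : g -> g -> g) (T : g -> g)
    (hg : is_erb_lie mu lambda br T)
    (hH2 : cohomology_vanishes mu lambda br T 2) :
  rigid mu lambda br T.
Proof.
move=> m Tt [/all_and2[bil_m _] lin_Tt m0 Tt0 erb_m].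
have [[bil_br _ _] lin_T _] := hg.
have [br' eq_br] := bilinear_forP bil_br; have [T' eq_T] := linear_forP lin_T.
have [m' eq_m] := bilinear_familyP bil_m.
have [Tt' eq_Tt] := linear_familyP lin_Tt.
by subst br T m Tt; exact: deformation_trivial hg m0 Tt0 erb_m hH2.
Qed.
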